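(* Let $(G,\{T_v,\rho_v\}_{v\in V},\{\phi_e\}_{e\in E})$ be a Mauldin-Williams graph such that $G$ has no sinks and no sources, let $T=\coprod_{v\in V}T_v$, $A=C(T)$, and let $\mathcal{X}=C(E\times_G T)$ be the associated $C^*$-correspondence over $A$. Let $K\subset T$ be the invariant set, and suppose that $K$ is a proper subset of $T$. Put $U=T\setminus K$ and let $I_U=C_0(U)$ be the ideal of functions in $A$ vanishing on $K$. Let $k_A:A\to\mathcal{O}_{\mathcal{X}}$ be the canonical $*$-homomorphism. Then the ideal $\mathcal{I}(I_U)$ of the Cuntz-Pimsner algebra $\mathcal{O}_{\mathcal{X}}$ generated by $k_A(I_U)$ is equal to $0$.
   Context: Graphs. A graph $G=(V,E,r,s)$ consists of finite sets $V$ (vertices) and $E$ (edges) and maps $r,s:E\to V$ (range and source). No sinks means $s$ is surjective; no sources means $r$ is surjective. Mauldin-Williams graph. A system $(G,\{T_v,\rho_v\}_{v\in V},\{\phi_e\}_{e\in E})$ where $G=(V,E,r,s)$ is a graph, each $(T_v,\rho_v)$ is a nonempty compact metric space, and for each $e\in E$, $\phi_e:T_{r(e)}\to T_{s(e)}$ satisfies $\rho_{s(e)}(\phi_e(x),\phi_e(y))\le c\,\rho_{r(e)}(x,y)$ for all $x,y\in T_{r(e)}$, with a constant $0<c<1$ independent of $e$. There is a unique family $(K_v)_{v\in V}$ of nonempty compact sets $K_v\subset T_v$ with $K_v=\bigcup_{e\in E,\,s(e)=v}\phi_e(K_{r(e)})$ for all $v\in V$; the invariant set is $K=\bigcup_{v\in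 V}K_v\subset T$. The correspondence. Let $T=\coprod_{v\in V}T_v$ (disjoint union), $A=C(T)$, $E\times_G T=\{(e,x)\in E\times T: x\in T_{r(e)}\}$ and $\mathcal{X}=C(E\times_G T)$, with $(\xi\cdot a)(e,x)=\xi(e,x)a(x)$, $(a\cdot\xi)(e,x)=a(\phi_e(x))\,\xi(e,x)$, and $\langle\xi,\eta\rangle_A(x)=\sum_{e\in E,\ x\in T_{r(e)}}\overline{\xi(e,x)}\,\eta(e,x)$, for $a\in A$, $\xi,\eta\in\mathcal{X}$. The left action is the $*$-homomorphism $\Phi:A\to\mathcal{L}(\mathcal{X})$, $\Phi(a)\xi=a\cdot\xi$, into the adjointable operators. Cuntz-Pimsner algebra. A Toeplitz representation of $\mathcal{X}$ in a $C^*$-algebra $B$ is a pair $(\psi,\pi)$ with $\psi:\mathcal{X}\to B$ linear and $\pi:A\to B$ a $*$-homomorphism such that $\psi(\xi\cdot a)=\psi(\xi)\pi(a)$, $\psi(a\cdot\xi)=\pi(a)\psi(\xi)$ and $\psi(\xi)^*\psi(\eta)=\pi(\langle\xi,\eta\rangle_A)$. It induces a $*$-homomorphism $\pi^{(1)}:\mathcal{K}(\mathcal{X})\to B$ with $\pi^{(1)}(\Theta_{\xi,\eta})=\psi(\xi)\psi(\eta)^*$, where $\Theta_{\xi,\eta}(\zeta)=\xi\cdot\langle\eta,\zeta\rangle_A$ and $\mathcal{K}(\mathcal{X})$ is the closed linear span of the operators $\Theta_{\xi,\eta}$. Put $J(\mathcal{X})=\Phi^{-1}(\mathcal{K}(\mathcal{X}))$.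 The representation is Cuntz-Pimsner covariant if $\pi^{(1)}(\Phi(a))=\pi(a)$ for all $a\in J(\mathcal{X})$. $\mathcal{O}_{\mathcal{X}}$ is the $C^*$-algebra generated by a universal Cuntz-Pimsner covariant Toeplitz representation $(k_{\mathcal{X}},k_A)$: every Cuntz-Pimsner covariant Toeplitz representation $(\psi,\pi)$ in $B$ factors through a $*$-homomorphism $\mathcal{O}_{\mathcal{X}}\to B$ carrying $k_{\mathcal{X}}(\xi)$ to $\psi(\xi)$ and $k_A(a)$ to $\pi(a)$. *)

(* Defs.v *)
From HB Require Import structures.
From mathcomp Require Import all_boot all_order all_algebra.
From mathcomp Require Import all_classical all_reals all_analysis.
From mathcomp Require Import complex ring.

Set Implicit Arguments.
Unset Strict Implicit.
Unset Printing Implicit Defensive.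

Import Order.TTheory GRing.Theory Num.Theory.
Import numFieldNormedType.Exports.

Local Open Scope classical_set_scope.
Local Open Scope complex_scope.
Local Open Scope ring_scope.

(* Not necessarily unital: all the rings of the library have a unit, hence the
   multiplication [amul] is given separately. *)
HB.mixin Record CompleteNormedModule_isCStarAlgebra (R : realType) B
    & CompleteNormedModule R[i] B := {
  amul : B -> B -> B;
  astar : B -> B;
  amulA : associative amul;
  amulDl : left_distributive amul +%R;
  amulDr : right_distributive amul +%R;
  amulZl : forall (c : R[i]) x y, amul (c *: x) y = c *: amul x y;
  amulZr : forall (c : R[i]) x y, amul x (c *: y) = c *: amul x y;
  astarK : involutive astar;
  astarD : {morph astar : x y / x + y};
  astarZ : forall (c : R[i]) x, astar (c *: x) = Num.conj c *: astar x;
  astarM : forall x y, astar (amul x y) = amul (astar y) (astar x);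
  norm_amul : forall x y, `|amul x y| <= `|x| * `|y|;
  cstar_identity : forall x, `|amul (astar x) x| = `|x| ^+ 2
}.

#[short(type="cstarAlgType")]
HB.structure Definition CStarAlgebra (R : realType) :=
  {B of CompleteNormedModule R[i] B & CompleteNormedModule_isCStarAlgebra R B}.

Record star_hom (R : realType) (A B : cstarAlgType R) (f : A -> B) : Prop :=
  StarHom {
    star_homD : {morph f : x y / x + y};
    star_homZ : forall (c : R[i]) x, f (c *: x) = c *: f x;
    star_homM : {morph f : x y / amul x y};
    star_homV : {morph f : x / astar x}
  }.

HB.mixin Record Topological_isCompact T & Topological T := {
  compact_setT : compact [set: T]
}.

#[short(type="compactType")]
HB.structure Definition Compact := {T of Topological T & Topological_isCompact T}.

#[short(type="compactMetricType")]
HB.structure Definition CompactMetric (R : realType) :=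
  {T of Metric R T & Topological_isCompact T}.

Section complex_topology.
Context {R : realType}.
Implicit Types (z : R[i]).

Definition Cmod z : R := complex.Re `|z|.

Lemma CmodE z : `|z| = (Cmod z)%:C.
Proof. by rewrite /Cmod RRe_real// normr_real. Qed.

Lemma norm_realC (x : R) : `|x%:C| = `|x|%:C :> R[i].
Proof. by rewrite normc_def /= expr0n addr0 sqrtr_sqr. Qed.

Lemma Cmod_ge0 z : 0 <= Cmod z.
Proof. by rewrite -ler0c -CmodE normr_ge0. Qed.

Lemma gt0_realC (e : R[i]) : 0 < e -> exists2 d : R, 0 < d & e = d%:C.
Proof.
move=> e0; exists (complex.Re e).
  by move: e0; rewrite ltcE /= => /andP[].
by rewrite RRe_real// gtr0_real.
Qed.

Lemma Cmod_Re z : `|complex.Re z| <= Cmod z.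
Proof. by rewrite -lecR -CmodE normc_ge_Re. Qed.

Lemma Cmod_Im z : `|complex.Im z| <= Cmod z.
Proof.
have := Cmod_Re (z * 'i); rewrite ReiNIm normrN => /le_trans; apply.
by rewrite -lecR -!CmodE normrM (_ : `|'i| = 1) ?mulr1// normc_def /=
  expr0n add0r expr1n sqrtr1.
Qed.

Lemma Re_continuous : continuous (@complex.Re R : R[i]^o -> R).
Proof.
move=> z; apply/(@cvgrPdist_lt _ R _ (nbhs (z : R[i]^o))) => e e0.
have eC0 : 0 < e%:C :> R[i] by rewrite ltcR.
apply: (@filterS _ (nbhs (z : R[i]^o)) _ _ _ _ (nbhsx_ballx (z : R[i]^o) _ eC0)).
move=> w; rewrite -ball_normE /= CmodE ltcR; apply: le_lt_trans.
by rewrite -raddfB; exact: Cmod_Re.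
Qed.

Lemma Im_continuous : continuous (@complex.Im R : R[i]^o -> R).
Proof.
move=> z; apply/(@cvgrPdist_lt _ R _ (nbhs (z : R[i]^o))) => e e0.
have eC0 : 0 < e%:C :> R[i] by rewrite ltcR.
apply: (@filterS _ (nbhs (z : R[i]^o)) _ _ _ _ (nbhsx_ballx (z : R[i]^o) _ eC0)).
move=> w; rewrite -ball_normE /= CmodE ltcR; apply: le_lt_trans.
by rewrite -raddfB; exact: Cmod_Im.
Qed.

Lemma Cmod_le_ReIm z : Cmod z <= `|complex.Re z| + `|complex.Im z|.
Proof.
rewrite -lecR -CmodE rmorphD /= {1}(complexE z).
apply: (le_trans (ler_normD _ _)).
by rewrite normrM !norm_realC (_ : `|'i| = 1) ?mul1r// normc_def /=
  expr0n add0r expr1n sqrtr1.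
Qed.

Lemma complex_complete (F : set_system R[i]^o) :
  ProperFilter F -> cauchy F -> cvg F.
Proof.
move=> FF /cauchy_ballP cF; apply/cvg_ex.
have cpart (p : R[i]^o -> R) : (forall x y, `|p x - p y| <= Cmod (x - y)) ->
    exists l : R, p @ F --> l.
  move=> pC; apply/cvg_ex; apply: (@R_complete R (p @ F)).
  apply/cauchy_ballP => e e0; rewrite near_map2.
  have eC0 : 0 < e%:C :> R[i] by rewrite ltcR.
  have := cF _ eC0; apply: filterS => -[x y] /=.
  rewrite -!ball_normE /= CmodE ltcR; exact: le_lt_trans.
have [a Fa] : exists a : R, (@complex.Re R : R[i]^o -> R) @ F --> a.
  by apply: cpart => x y; rewrite -raddfB; exact: Cmod_Re.
have [b Fb] : exists b : R, (@complex.Im R : R[i]^o -> R) @ F --> b.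
  by apply: cpart => x y; rewrite -raddfB; exact: Cmod_Im.
exists (a +i* b); apply/(@cvgrPdist_lt _ R[i]^o) => e /gt0_realC[d d0 ->].
have d20 : 0 < d / 2 by rewrite divr_gt0.
near=> z; rewrite CmodE ltcR.
apply: (le_lt_trans (Cmod_le_ReIm _)).
rewrite !raddfB /= (splitr d) ltrD//.
- by near: z; move/cvgrPdist_lt : Fa; exact.
- by near: z; move/cvgrPdist_lt : Fb; exact.
Unshelve. all: by end_near. Qed.

End complex_topology.

(* [R[i]^o] is the field of complex numbers with its normed topology. *)
Record contC (R : realType) (X : compactType) := ContC {
  contC_fun :> X -> R[i];
  contC_continuous : continuous (contC_fun : X -> R[i]^o)
}.
Arguments contC_continuous {R X} c.

Section contC.
Context {R : realType} {X : compactType}.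
Local Notation C := (R[i]).
Local Notation CX := (contC R X).

Lemma contCP (f g : CX) : (forall x, f x = g x) -> f = g.
Proof.
case: f g => [f cf] [g cg] /= /funext fg; rewrite fg in cf *.
by congr ContC; exact: Prop_irrelevance.
Qed.

HB.instance Definition _ := gen_eqMixin CX.
HB.instance Definition _ := gen_choiceMixin CX.

Lemma contC_add_subproof (f g : CX) :
  continuous ((fun x => f x + g x) : X -> R[i]^o).
Proof. by move=> x; apply: (@cvgD _ R[i]^o); exact: contC_continuous. Qed.

Lemma contC_opp_subproof (f : CX) : continuous ((fun x => - f x) : X -> R[i]^o).
Proof. by move=> x; apply: (@cvgN _ R[i]^o); exact: contC_continuous. Qed.

Lemma contC_zero_subproof : continuous ((fun=> 0) : X -> R[i]^o).
Proof. by move=> x; exact: cvg_cst. Qed.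

Lemma contC_mul_subproof (f g : CX) :
  continuous ((fun x => f x * g x) : X -> R[i]^o).
Proof. by move=> x; apply: (@cvgM C); exact: contC_continuous. Qed.

Lemma contC_scale_subproof (c : C) (f : CX) :
  continuous ((fun x => c * f x) : X -> R[i]^o).
Proof.
by move=> x; apply: (@cvgM C); [exact: cvg_cst|exact: contC_continuous].
Qed.

Lemma contC_conj_subproof (f : CX) :
  continuous ((fun x => Num.conj (f x)) : X -> R[i]^o).
Proof.
move=> x; apply/(@cvgrPdist_lt _ R[i]^o) => e e0.
have /(@cvgrPdist_lt _ R[i]^o)/(_ e e0) := contC_continuous f x.
by apply: filterS => y; rewrite -rmorphB norm_conjC.
Qed.

Let add (f g : CX) := ContC (@contC_add_subproof f g).
Let opp (f : CX) := ContC (@contC_opp_subproof f).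
Let zero := ContC (contC_zero_subproof).
Let scale (c : C) (f : CX) :=
  ContC (@contC_scale_subproof c f).

Let addA : associative add.
Proof. by move=> f g h; apply/contCP => x; exact: addrA. Qed.
Let addC : commutative add.
Proof. by move=> f g; apply/contCP => x; exact: addrC. Qed.
Let add0 : left_id zero add.
Proof. by move=> f; apply/contCP => x; exact: add0r. Qed.
Let addN : left_inverse zero opp add.
Proof. by move=> f; apply/contCP => x; exact: addNr. Qed.

HB.instance Definition _ := GRing.isZmodule.Build CX addA addC add0 addN.

Let scaleA a b f : scale a (scale b f) = scale (a * b) f.
Proof. by apply/contCP => x; exact: mulrA. Qed.
Let scale1 : left_id 1 scale.
Proof. by move=> f; apply/contCP => x; exact: mul1r. Qed.
Let scaleDr : right_distributive scale +%R.
Proof. by move=> a f g; apply/contCP => x; exact: mulrDr. Qed.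
Let scaleDl f : {morph scale^~ f : a b / a + b}.
Proof. by move=> a b; apply/contCP => x; exact: mulrDl. Qed.

HB.instance Definition _ :=
  GRing.Zmodule_isLmodule.Build C CX scaleA scale1 scaleDr scaleDl.

Definition contC_mul (f g : CX) : CX := ContC (@contC_mul_subproof f g).
Definition contC_conj (f : CX) : CX := ContC (@contC_conj_subproof f).

Lemma contC0E x : (0 : CX) x = 0. Proof. by []. Qed.
Lemma contCDE (f g : CX) x : (f + g) x = f x + g x. Proof. by []. Qed.
Lemma contCNE (f : CX) x : (- f) x = - f x. Proof. by []. Qed.
Lemma contCBE (f g : CX) x : (f - g) x = f x - g x. Proof. by []. Qed.
Lemma contCZE c (f : CX) x : (c *: f) x = c * f x. Proof. by []. Qed.
Lemma contC_mulE (f g : CX) x : contC_mul f g x = f x * g x. Proof. by []. Qed.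
Lemma contC_conjE (f : CX) x : contC_conj f x = Num.conj (f x). Proof. by []. Qed.
Definition supnorm (f : CX) : C := (sup (range (Cmod \o f)))%:C.

Lemma Cmod_contC_continuous (f : CX) : continuous (Cmod \o f : X -> R).
Proof.
move=> x; apply/(@cvgrPdist_lt _ R) => e e0.
have eC0 : 0 < e%:C :> C by rewrite ltcR.
have /(@cvgrPdist_lt _ R[i]^o)/(_ _ eC0) := contC_continuous f x.
apply: filterS => y; rewrite CmodE ltcR; apply: le_lt_trans => /=.
rewrite -lecR -norm_realC rmorphB /= -!CmodE; exact: ler_dist_dist.
Qed.

Lemma contC_has_ubound (f : CX) : has_ubound (range (Cmod \o f)).
Proof.
have cR : compact (range (Cmod \o f)).
  apply: continuous_compact; last exact: compact_setT.
  by apply: continuous_subspaceT; exact: Cmod_contC_continuous.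
have [M [_ MB]] := @compact_bounded R R^o _ cR.
exists (M + 1) => _ [x _ <-].
apply: (le_trans (ler_norm _)); apply: (MB (M + 1)); last by exists x.
by rewrite ltrDl.
Qed.

Lemma le_supnorm (f : CX) x : `|f x| <= supnorm f.
Proof.
by rewrite CmodE lecR; apply: ub_le_sup; [exact: contC_has_ubound|exists x].
Qed.

Lemma supnorm_ge0 (f : CX) : 0 <= supnorm f.
Proof.
rewrite ler0c; have [[x _]|/nonemptyPn X0] := pselect ([set: X] !=set0).
  apply: (@le_trans _ _ (Cmod (f x))); first exact: Cmod_ge0.
  by apply: ub_le_sup; [exact: contC_has_ubound|exists x].
by rewrite X0 image_set0 sup0.
Qed.

Lemma supnorm_le (f : CX) (M : C) :
  0 <= M -> (forall x, `|f x| <= M) -> supnorm f <= M.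
Proof.
move=> M0 fM; rewrite -(@RRe_real _ M) ?ger0_real// lecR.
have MR : (complex.Re M)%:C = M by rewrite RRe_real// ger0_real.
have [[x _]|/nonemptyPn X0] := pselect ([set: X] !=set0).
  apply: ge_sup; first by exists (Cmod (f x)), x.
  by move=> _ [y _ <-]; rewrite -lecR -CmodE MR.
by rewrite X0 image_set0 sup0 -ler0c MR.
Qed.

Let supnormD f g : supnorm (f + g) <= supnorm f + supnorm g.
Proof.
apply: supnorm_le; first by rewrite addr_ge0 ?supnorm_ge0.
move=> x; rewrite contCDE (le_trans (ler_normD _ _))// lerD ?le_supnorm//.
Qed.

Let supnormZ c f : supnorm (c *: f) = `|c| * supnorm f.
Proof.
apply/eqP; rewrite eq_le; apply/andP; split.
  apply: supnorm_le; first by rewrite mulr_ge0 ?supnorm_ge0.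
  by move=> x; rewrite contCZE normrM ler_wpM2l ?le_supnorm.
have [->|c0] := eqVneq c 0; first by rewrite normr0 mul0r supnorm_ge0.
rewrite -ler_pdivlMl ?normr_gt0//; apply: supnorm_le.
  by rewrite mulr_ge0 ?supnorm_ge0// invr_ge0.
move=> x; rewrite ler_pdivlMl ?normr_gt0// -normrM -contCZE.
exact: le_supnorm.
Qed.

Let supnorm_eq0 f : supnorm f = 0 -> f = 0.
Proof.
move=> f0; apply/contCP => x; apply/eqP; rewrite contC0E -normr_le0 -f0.
exact: le_supnorm.
Qed.

HB.instance Definition _ :=
  @Lmodule_isNormed.Build C CX supnorm supnormD supnormZ supnorm_eq0.

Lemma contC_normE (f : CX) : `|f| = supnorm f. Proof. by []. Qed.

Lemma contC_complete (F : set_system CX) : ProperFilter F -> cauchy F -> cvg F.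
Proof.
move=> FF /cauchy_ballP cF.
have evB (x : X) (f g : CX) : `|f x - g x| <= `|f - g|.
  by rewrite -contCBE; exact: le_supnorm.
have pt (x : X) : exists l : R[i]^o, (fun f : CX => f x : R[i]^o) @ F --> l.
  apply/cvg_ex; apply: complex_complete; apply/cauchy_ballP => e e0.
  rewrite near_map2; apply: filterS (cF e e0) => -[f g].
  by rewrite -!ball_normE /=; exact: le_lt_trans.
have /choice[g Fg] := pt.
have unif (e : C) : 0 < e -> \forall f \near F, 
      forall x, `|(f : CX) x - (g x : C)| <= e.
  move=> e0; have e20 : 0 < e / 2 by rewrite divr_gt0.
  have := cF _ e20; move=> /nearP_dep; apply: filterS => f Ff x.
  have /(@cvgrPdist_lt _ R[i]^o)/(_ _ e20) gx := Fg x.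
  near F => h.
  rewrite -(subrKA (h x)) (splitr e) (le_trans (ler_normD _ _))// lerD//.
    apply: (le_trans (evB _ _ _)); apply: ltW.
    by near: h; apply: filterS Ff => h; rewrite -ball_normE.
  by rewrite distrC ltW//; near: h.
have gc : continuous (g : X -> R[i]^o).
  move=> x; apply/(@cvgrPdist_lt _ R[i]^o) => e e0.
  have e30 : 0 < e / 3 by rewrite divr_gt0.
  near F => f.
  have fu : forall y, `|f y - g y| <= e / 3 by near: f; exact: unif.
  have /(@cvgrPdist_lt _ R[i]^o)/(_ _ e30) := contC_continuous f x.
  apply: filterS => y fxy.
  rewrite -(subrKA (f x)) -(subrKA (f y) (f x)).
  have -> : e = e / 3 + (e / 3 + e / 3) by field.
  rewrite (le_lt_trans (ler_normD _ _))// ler_ltD//; first by rewrite distrC.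
  rewrite (le_lt_trans (ler_normD _ _))// ltr_leD//.
apply/cvg_ex; exists (ContC gc); apply/cvgrPdist_le => e e0.
have := unif e e0; apply: filterS => f fg.
rewrite distrC; apply: supnorm_le; first exact: ltW.
by move=> x; rewrite contCBE.
Unshelve. all: by end_near. Qed.

HB.instance Definition _ := Uniform_isComplete.Build CX contC_complete.

Let mulA : associative contC_mul.
Proof. by move=> f g h; apply/contCP => x; exact: mulrA. Qed.
Let mulDl : left_distributive contC_mul +%R.
Proof. by move=> f g h; apply/contCP => x; exact: mulrDl. Qed.
Let mulDr : right_distributive contC_mul +%R.
Proof. by move=> f g h; apply/contCP => x; exact: mulrDr. Qed.
Let mulZl (c : C) f g : contC_mul (c *: f) g = c *: contC_mul f g.
Proof. by apply/contCP => x; rewrite !(contC_mulE, contCZE) mulrA. Qed.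
Let mulZr (c : C) f g : contC_mul f (c *: g) = c *: contC_mul f g.
Proof. by apply/contCP => x; rewrite !(contC_mulE, contCZE) mulrCA. Qed.
Let conjK : involutive contC_conj.
Proof. by move=> f; apply/contCP => x; exact: conjCK. Qed.
Let conjD : {morph contC_conj : f g / f + g}.
Proof. by move=> f g; apply/contCP => x; exact: rmorphD. Qed.
Let conjZ (c : C) f : contC_conj (c *: f) = Num.conj c *: contC_conj f.
Proof. by apply/contCP => x; exact: rmorphM. Qed.
Let conjM f g : contC_conj (contC_mul f g) =
  contC_mul (contC_conj g) (contC_conj f).
Proof.
by apply/contCP => x; rewrite !(contC_mulE, contC_conjE) rmorphM mulrC.
Qed.
Let normM f g : `|contC_mul f g| <= `|f| * `|g|.
Proof.
apply: supnorm_le; first by rewrite mulr_ge0.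
by move=> x; rewrite contC_mulE normrM ler_pM ?le_supnorm.
Qed.
Let normV f : `|contC_mul (contC_conj f) f| = `|f| ^+ 2.
Proof.
apply/eqP; rewrite eq_le; apply/andP; split.
  apply: supnorm_le; first by rewrite exprn_ge0.
  move=> x; rewrite contC_mulE contC_conjE mulrC -normCK normrX normr_id.
  by rewrite lerXn2r ?nnegrE// ?le_supnorm.
rewrite -[leRHS]sqrtCK lerXn2r ?nnegrE ?sqrtC_ge0//.
apply: supnorm_le; first by rewrite sqrtC_ge0.
move=> x; rewrite -(@ler_pXn2r _ 2) ?nnegrE ?sqrtC_ge0// sqrtCK.
apply: le_trans (le_supnorm _ x).
by rewrite contC_mulE contC_conjE mulrC -normCK normrX normr_id.
Qed.

HB.instance Definition _ := CompleteNormedModule_isCStarAlgebra.Build R CX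
  mulA mulDl mulDr mulZl mulZr conjK conjD conjZ conjM normM normV.

End contC.

(* A right Hilbert A-module, complete for the norm of its inner product, with a
   left action of A by adjointable operators. In [0 < e] with [e : R[i]] the
   number e is real, by definition of the order of R[i]. *)
HB.mixin Record Lmodule_isCorrespondence (R : realType) (A : cstarAlgType R) X
    & GRing.Lmodule R[i] X := {
  ract : X -> A -> X;
  lact : A -> X -> X;
  inner : X -> X -> A;
  ractDl : forall x y a, ract (x + y) a = ract x a + ract y a;
  ractDr : forall x a b, ract x (a + b) = ract x a + ract x b;
  ractZl : forall (c : R[i]) x a, ract (c *: x) a = c *: ract x a;
  ractZr : forall (c : R[i]) x a, ract x (c *: a) = c *: ract x a;
  ractA : forall x a b, ract (ract x a) b = ract x (amul a b);
  innerDr : forall x y z, inner x (y + z) = inner x y + inner x z;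
  innerZr : forall (c : R[i]) x y, inner x (c *: y) = c *: inner x y;
  inner_ract : forall x y a, inner x (ract y a) = amul (inner x y) a;
  inner_star : forall x y, astar (inner x y) = inner y x;
  inner_ge0 : forall x, exists a, inner x x = amul (astar a) a;
  inner_eq0 : forall x, inner x x = 0 -> x = 0;
  inner_complete : forall u : nat -> X,
    (forall e : R[i], 0 < e -> exists N, forall m n, (N <= m)%N -> (N <= n)%N ->
       sqrtC `|inner (u m - u n) (u m - u n)| < e) ->
    exists l, forall e : R[i], 0 < e -> exists N, forall n, (N <= n)%N ->
       sqrtC `|inner (u n - l) (u n - l)| < e;
  lactDl : forall a b x, lact (a + b) x = lact a x + lact b x;
  lactZl : forall (c : R[i]) a x, lact (c *: a) x = c *: lact a x;
  lactM : forall a b x, lact (amul a b) x = lact a (lact b x);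
  lact_adjoint : forall a x y, inner (lact a x) y = inner x (lact (astar a) y)
}.

#[short(type="correspondenceType")]
HB.structure Definition Correspondence (R : realType) (A : cstarAlgType R) :=
  {X of GRing.Lmodule R[i] X & Lmodule_isCorrespondence R A X}.

Section operators.
Context {R : realType} {A : cstarAlgType R} {X : correspondenceType A}.
Implicit Types (x y z : X) (S : X -> X).

Definition hnorm x : R[i] := sqrtC `|inner x x|.

Definition adjoint_pair S S' := forall x y, inner (S x) y = inner x (S' y).

(* L(X); adjointable maps are automatically A-linear and bounded *)
Definition adjointable : set (X -> X) := [set S | exists S', adjoint_pair S S'].

Definition theta x y z : X := ract x (inner y z).

Definition theta_span : set (X -> X) :=
  [set S | exists (n : nat) (c : 'I_n -> R[i]) (x y : 'I_n -> X),
     S = fun z => \sum_(i < n) c i *: theta (x i) (y i) z].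

(* K(X): the closure of [theta_span] in L(X) for the operator norm *)
Definition compact_op : set (X -> X) :=
  [set S | adjointable S /\ forall e : R[i], 0 < e ->
     exists2 F, theta_span F & forall z, hnorm (S z - F z) <= e * hnorm z].

(* J(X), the inverse image of K(X) under the left action *)
Definition covariance_ideal : set A := [set a | compact_op (lact a)].

End operators.

Arguments covariance_ideal {R A} X.

Section representations.
Context {R : realType} {A : cstarAlgType R} {X : correspondenceType A}.
Context {B : cstarAlgType R}.
Implicit Types (psi : X -> B) (pi : A -> B).

Record toeplitz psi pi : Prop := Toeplitz {
  toeplitzD : {morph psi : x y / x + y};
  toeplitzZ : forall (c : R[i]) x, psi (c *: x) = c *: psi x;
  toeplitz_star_hom : star_hom pi;
  toeplitz_ract : forall x a, psi (ract x a) = amul (psi x) (pi a);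
  toeplitz_lact : forall a x, psi (lact a x) = amul (pi a) (psi x);
  toeplitz_inner : forall x y, amul (astar (psi x)) (psi y) = pi (inner x y)
}.

(* [pi1] is the *-homomorphism K(X) -> B induced by [psi]; its values outside
   K(X) are irrelevant. *)
Record induced_hom psi (pi1 : (X -> X) -> B) : Prop := InducedHom {
  induced_homD : forall S S', compact_op S -> compact_op S' ->
    pi1 (fun x => S x + S' x) = pi1 S + pi1 S';
  induced_homZ : forall (c : R[i]) S, compact_op S ->
    pi1 (fun x => c *: S x) = c *: pi1 S;
  induced_homM : forall S S', compact_op S -> compact_op S' ->
    pi1 (S \o S') = amul (pi1 S) (pi1 S');
  induced_homV : forall S S', compact_op S -> adjoint_pair S S' ->
    pi1 S' = astar (pi1 S);
  induced_hom_theta : forall x y,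
    pi1 (theta x y) = amul (psi x) (astar (psi y))
}.

Definition covariant_toeplitz psi pi :=
  toeplitz psi pi /\
  exists2 pi1, induced_hom psi pi1 &
    forall a, covariance_ideal X a -> pi1 (lact a) = pi a.

End representations.

Section subalgebras.
Context {R : realType} {B : cstarAlgType R}.

Record cstar_subalg (S : set B) : Prop := CStarSubalg {
  cstar_subalg_closed : closed S;
  cstar_subalg0 : S 0;
  cstar_subalgD : forall x y, S x -> S y -> S (x + y);
  cstar_subalgZ : forall (c : R[i]) x, S x -> S (c *: x);
  cstar_subalgM : forall x y, S x -> S y -> S (amul x y);
  cstar_subalgV : forall x, S x -> S (astar x)
}.

Record closed_ideal (I : set B) : Prop := ClosedIdeal {
  closed_ideal_closed : closed I;
  closed_ideal0 : I 0;
  closed_idealD : forall x y, I x -> I y -> I (x + y);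
  closed_idealZ : forall (c : R[i]) x, I x -> I (c *: x);
  closed_idealMl : forall x y, I y -> I (amul x y);
  closed_idealMr : forall x y, I x -> I (amul x y)
}.

Definition ideal_generated (S : set B) : set B :=
  \bigcap_(I in [set I | closed_ideal I /\ S `<=` I]) I.

End subalgebras.

Record cuntz_pimsner (R : realType) (A : cstarAlgType R)
    (X : correspondenceType A) (O : cstarAlgType R)
    (kX : X -> O) (kA : A -> O) : Prop := CuntzPimsner {
  cuntz_pimsner_covariant : covariant_toeplitz kX kA;
  cuntz_pimsner_generated : forall S, cstar_subalg S ->
    range kX `<=` S -> range kA `<=` S -> S = [set: O];
  cuntz_pimsner_universal : forall (B : cstarAlgType R) (psi : X -> B)
      (pi : A -> B), covariant_toeplitz psi pi ->
    exists rho : O -> B,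
      [/\ star_hom rho, rho \o kX = psi & rho \o kA = pi]
}.

Record mauldin_williams (R : realType) := MauldinWilliams {
  mw_vertex : finType;
  mw_edge : finType;
  mw_range : mw_edge -> mw_vertex;
  mw_source : mw_edge -> mw_vertex;
  mw_space : mw_vertex -> compactMetricType R;
  mw_space_nonempty : forall v, [set: mw_space v] !=set0;
  mw_map : forall e, mw_space (mw_range e) -> mw_space (mw_source e);
  mw_map_contraction : exists2 c : R, 0 < c < 1 &
    forall e (x y : mw_space (mw_range e)),
      mdist (mw_map x) (mw_map y) <= c * mdist x y
}.

Arguments mw_space {R} G _ : rename.
Arguments mw_range {R} G _ : rename.
Arguments mw_source {R} G _ : rename.
Arguments mw_map {R} G e _ : rename.

HB.instance Definition _ (I : finType) (T : I -> compactType) :=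
  Topological_isCompact.Build {i : I & T i}
    (sigT_compact finite_finset (fun i => @compact_setT (T i))).

Section mauldin_williams.
Context {R : realType} (G : mauldin_williams R).

Definition no_sinks := forall v, exists e, mw_source G e = v.
Definition no_sources := forall v, exists e, mw_range G e = v.

Definition total_space : compactType := {v : mw_vertex G & mw_space G v}.

(* E x_G T: the pairs (e, x) with x in T_(r e) *)
Definition edge_space : compactType :=
  {e : mw_edge G & mw_space G (mw_range G e)}.

Definition mw_corr := contC R edge_space.

Definition to_total v (x : mw_space G v) : total_space := existT _ v x.
Definition to_edge e (x : mw_space G (mw_range G e)) : edge_space := existT _ e x.

Local Notation A := (contC R total_space).
Local Notation X := mw_corr.

Lemma mw_map_continuous e : continuous (mw_map G e).
Proof.
have [c /andP[c0 c1] cmap] := mw_map_contraction G.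
move=> x; apply/cvg_ballP => r r0; near=> y; rewrite ballEmdist /=.
apply: (le_lt_trans (cmap _ _ _)).
have : ball x r y by near: y; exact: nbhsx_ballx.
by rewrite ballEmdist /=; apply: le_lt_trans; rewrite ler_piMl ?mdist_ge0 ?ltW.
Unshelve. all: by end_near. Qed.

Lemma total_space_continuous (U : topologicalType) (f : total_space -> U) :
  (forall v, continuous (f \o @to_total v)) -> continuous f.
Proof. by move=> cf [v x]; exact: (cf v x). Qed.

Lemma edge_space_continuous (U : topologicalType) (f : edge_space -> U) :
  (forall e, continuous (f \o @to_edge e)) -> continuous f.
Proof. by move=> cf [v x]; exact: (cf v x). Qed.

Lemma to_total_continuous v : continuous (@to_total v).
Proof. exact: existT_continuous. Qed.

Lemma to_edge_continuous e : continuous (@to_edge e).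
Proof. exact: existT_continuous. Qed.

Definition mw_ract_fun (xi : X) (a : A) (p : edge_space) : R[i] :=
  xi p * a (to_total (tagged p)).

Definition mw_lact_fun (a : A) (xi : X) (p : edge_space) : R[i] :=
  a (to_total (mw_map G (tag p) (tagged p))) * xi p.

(* [untag 0 F p] is [F x] if p = (v, x) with v = r e, and 0 otherwise: the sum
   is over the edges e such that p is in T_(r e). *)
Definition mw_inner_fun (xi eta : X) (p : total_space) : R[i] :=
  \sum_(e : mw_edge G)
    untag 0 (fun x : mw_space G (mw_range G e) =>
      Num.conj (xi (to_edge x)) * eta (to_edge x)) p.

Lemma mw_ract_subproof xi a : continuous (mw_ract_fun xi a : _ -> R[i]^o).
Proof.
apply: edge_space_continuous => e x; apply: (@cvgM R[i]).
- exact: (continuous_comp (@to_edge_continuous e x) (contC_continuous xi _)).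
- exact: (continuous_comp (@to_total_continuous _ x) (contC_continuous a _)).
Qed.

Lemma mw_lact_subproof a xi : continuous (mw_lact_fun a xi : _ -> R[i]^o).
Proof.
apply: edge_space_continuous => e x; apply: (@cvgM R[i]); last first.
  exact: (continuous_comp (@to_edge_continuous e x) (contC_continuous xi _)).
exact: (continuous_comp (continuous_comp (@mw_map_continuous e x)
  (@to_total_continuous _ _)) (contC_continuous a _)).
Qed.

Lemma untag_to_total e (f : mw_space G (mw_range G e) -> R[i])
    (x : mw_space G (mw_range G e)) :
  untag 0 f (to_total x) = f x.
Proof. by rewrite (untagE _ _ (erefl _ : tag (to_total x) = mw_range G e)). Qed.

Lemma sum_continuousC (T : topologicalType) (I : Type) (r : seq I)
    (f : I -> T -> R[i]^o) :
  (forall i, continuous (f i)) -> continuous (fun x => \sum_(i <- r) f i x).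
Proof.
move=> cf; elim: r => [|i r IH].
  rewrite (_ : (fun _ => _) = (fun=> 0)); first by move=> x; exact: cvg_cst.
  by apply/funext => x; rewrite big_nil.
rewrite (_ : (fun _ => _) = (fun x => f i x + \sum_(j <- r) f j x)).
  by move=> x; apply: (@cvgD _ R[i]^o); [exact: cf|exact: IH].
by apply/funext => x; rewrite big_cons.
Qed.

Lemma untag_continuous e (f : mw_space G (mw_range G e) -> R[i]^o) :
  continuous f ->
  continuous ((fun p => untag 0 f p) : total_space -> R[i]^o).
Proof.
move=> cf; apply: total_space_continuous => v.
have [ev|ev] := eqVneq (mw_range G e) v.
  subst v; rewrite (_ : _ \o _ = f) //.
  by apply/funext => x; exact: untag_to_total.
rewrite (_ : _ \o _ = fun=> 0); first by move=> x; exact: cvg_cst.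
by apply/funext => x; apply: untag_dflt; rewrite eq_sym.
Qed.

Lemma mw_inner_subproof xi eta :
  continuous (mw_inner_fun xi eta : _ -> R[i]^o).
Proof.
apply: sum_continuousC => e; apply: untag_continuous => x.
apply: (@cvgM R[i]).
  exact: (continuous_comp (@to_edge_continuous e x)
    (contC_continuous (contC_conj xi) _)).
exact: (continuous_comp (@to_edge_continuous e x) (contC_continuous eta _)).
Qed.

Definition mw_ract (xi : X) (a : A) : X := ContC (@mw_ract_subproof xi a).
Definition mw_lact (a : A) (xi : X) : X := ContC (@mw_lact_subproof a xi).
Definition mw_inner (xi eta : X) : A := ContC (@mw_inner_subproof xi eta).

Lemma untag_case e (p : total_space) :
  (exists x : mw_space G (mw_range G e), p = to_total x /\
     forall f : _ -> R[i], untag 0 f p = f x) \/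
  (forall f : mw_space G (mw_range G e) -> R[i], untag 0 f p = 0).
Proof.
case: p => v x; have [ev|ev] := eqVneq (mw_range G e) v.
  by subst v; left; exists x; split=> // f; exact: untag_to_total.
by right=> f; apply: untag_dflt; rewrite eq_sym.
Qed.

Lemma mw_inner_selfE (xi : X) (p : total_space) : mw_inner xi xi p =
  \sum_(e : mw_edge G)
    untag 0 (fun x : mw_space G (mw_range G e) => `|xi (to_edge x)| ^+ 2) p.
Proof.
apply: eq_bigr => e _.
by have [[x [_ F]]|F] := untag_case e p; rewrite !F// normCK mulrC.
Qed.

Lemma untag_sqr_ge0 (xi : X) (p : total_space) e :
  0 <= untag 0 (fun x : mw_space G (mw_range G e) => `|xi (to_edge x)| ^+ 2) p.
Proof.
by have [[x [_ F]]|F] := untag_case e p; rewrite F// exprn_ge0.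
Qed.

Lemma mw_inner_self_ge0 (xi : X) p : 0 <= mw_inner xi xi p.
Proof. by rewrite mw_inner_selfE sumr_ge0// => e _; exact: untag_sqr_ge0. Qed.

Lemma le_mw_inner (xi : X) e (x : mw_space G (mw_range G e)) :
  `|xi (to_edge x)| ^+ 2 <= mw_inner xi xi (to_total x).
Proof.
rewrite mw_inner_selfE (bigD1 e)//= untag_to_total lerDl sumr_ge0// => f _.
exact: untag_sqr_ge0.
Qed.

Lemma mw_supnorm_le (xi : X) : `|xi| <= sqrtC `|mw_inner xi xi|.
Proof.
apply: supnorm_le; first by rewrite sqrtC_ge0.
move=> [e x]; rewrite -(@ler_pXn2r _ 2) ?nnegrE ?sqrtC_ge0// sqrtCK.
apply: (le_trans (le_mw_inner xi x)); apply: le_trans (le_supnorm _ _).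
exact: real_ler_norm (ger0_real (mw_inner_self_ge0 _ _)).
Qed.

Lemma mw_inner_le (xi : X) : `|mw_inner xi xi| <= #|mw_edge G|%:R * `|xi| ^+ 2.
Proof.
apply: supnorm_le; first by rewrite mulr_ge0// exprn_ge0.
move=> p; rewrite ger0_norm ?mw_inner_self_ge0// mw_inner_selfE.
rewrite mulr_natl -sumr_const; apply: ler_sum => e _.
have [[x [_ F]]|F] := untag_case e p; rewrite F ?exprn_ge0//.
by rewrite lerXn2r ?nnegrE//; exact: le_supnorm.
Qed.

Let ractDl (x y : X) a : mw_ract (x + y) a = mw_ract x a + mw_ract y a.
Proof. by apply/contCP => p; exact: mulrDl. Qed.
Let ractDr (x : X) a b : mw_ract x (a + b) = mw_ract x a + mw_ract x b.
Proof. by apply/contCP => p; exact: mulrDr. Qed.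
Let ractZl (c : R[i]) (x : X) a : mw_ract (c *: x) a = c *: mw_ract x a.
Proof. by apply/contCP => p; rewrite contCZE /= /mw_ract_fun contCZE mulrA. Qed.
Let ractZr (c : R[i]) (x : X) a : mw_ract x (c *: a) = c *: mw_ract x a.
Proof. by apply/contCP => p; rewrite contCZE /= /mw_ract_fun contCZE mulrCA. Qed.
Let ractA (x : X) a b : mw_ract (mw_ract x a) b = mw_ract x (amul a b).
Proof. by apply/contCP => p; rewrite /= /mw_ract_fun mulrA. Qed.

Let innerDr (x y z : X) : mw_inner x (y + z) = mw_inner x y + mw_inner x z.
Proof.
apply/contCP => p; rewrite contCDE /= -big_split; apply: eq_bigr => e _ /=.
by have [[t [_ F]]|F] := untag_case e p; rewrite !F ?addr0// mulrDr.
Qed.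

Let innerZr (c : R[i]) (x y : X) : mw_inner x (c *: y) = c *: mw_inner x y.
Proof.
apply/contCP => p; rewrite contCZE /= mulr_sumr; apply: eq_bigr => e _ /=.
by have [[t [_ F]]|F] := untag_case e p; rewrite !F ?mulr0// mulrCA.
Qed.

Let inner_ract (x y : X) a : mw_inner x (mw_ract y a) = amul (mw_inner x y) a.
Proof.
apply/contCP => p; rewrite contC_mulE /= mulr_suml; apply: eq_bigr => e _ /=.
by have [[t [-> F]]|F] := untag_case e p; rewrite !F ?mul0r// -mulrA.
Qed.

Let inner_star (x y : X) : astar (mw_inner x y) = mw_inner y x.
Proof.
apply/contCP => p; rewrite contC_conjE /= rmorph_sum; apply: eq_bigr => e _ /=.
have [[t [_ F]]|F] := untag_case e p; rewrite !F ?rmorph0//.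
by rewrite rmorphM mulrC; congr (_ * _); exact: conjCK.
Qed.

Lemma sqrt_continuous_subproof (a : A) :
  continuous ((fun p => (Num.sqrt (complex.Re (a p)))%:C) : _ -> R[i]^o).
Proof.
have cRC : continuous (real_complex R : R -> R[i]^o).
  move=> x; apply/(@cvgrPdist_lt _ R[i]^o) => e /gt0_realC[d d0 ->].
  have /(@cvgrPdist_lt _ R)/(_ _ d0) := @cvg_id _ (nbhs x).
  by apply: filterS => y; rewrite -rmorphB norm_realC ltcR.
move=> p; exact: (continuous_comp (continuous_comp (continuous_comp
  (contC_continuous a p) (@Re_continuous R _)) (@sqrt_continuous R _)) (cRC _)).
Qed.

Let inner_ge0 (x : X) : exists a : A, mw_inner x x = amul (astar a) a.
Proof.
exists (ContC (@sqrt_continuous_subproof (mw_inner x x))).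
apply/contCP => p; rewrite contC_mulE contC_conjE [in RHS]/=.
have p0 := mw_inner_self_ge0 x p.
rewrite mulrC -normCK norm_realC -rmorphXn /= ger0_norm ?sqrtr_ge0// sqr_sqrtr.
  by rewrite RRe_real// ger0_real.
by move: p0; rewrite lecE => /andP[].
Qed.

Let inner_eq0 (x : X) : mw_inner x x = 0 -> x = 0.
Proof.
move=> x0; apply/eqP; rewrite -normr_le0; apply: (le_trans (mw_supnorm_le x)).
by rewrite x0 normr0 sqrtC0.
Qed.

Let inner_complete (u : nat -> X) :
  (forall e : R[i], 0 < e -> exists N, forall m n, (N <= m)%N -> (N <= n)%N ->
     sqrtC `|mw_inner (u m - u n) (u m - u n)| < e) ->
  exists l, forall e : R[i], 0 < e -> exists N, forall n, (N <= n)%N ->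
     sqrtC `|mw_inner (u n - l) (u n - l)| < e.
Proof.
move=> cu; have : cvg (u @ \oo).
  apply: (@cauchy_cvg (contC R edge_space)); apply/cauchyP => e /cu[N uN].
  exists (u N); exists N => // n /= Nn; rewrite -ball_normE /=.
  by apply: (le_lt_trans (mw_supnorm_le _)); exact: uN.
move=> /cvg_ex[l ul]; exists l => e e0.
pose k : R[i] := sqrtC #|mw_edge G|%:R + 1.
have k0 : 0 < k by rewrite ltr_wpDl// sqrtC_ge0.
have /(@cvgrPdist_lt _ (contC R edge_space))/(_ _ (divr_gt0 e0 k0))[N _ uN] := ul.
exists N => n /uN /= ne; apply: le_lt_trans (_ : k * `|u n - l| < e).
  have ku0 : 0 <= k * `|u n - l| by rewrite mulr_ge0 ?(ltW k0).
  rewrite -[leRHS](sqrCK ku0) ler_sqrtC ?nnegrE// ?exprn_ge0//.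
  apply: (le_trans (mw_inner_le _)); rewrite exprMn ler_wpM2r ?exprn_ge0//.
  rewrite -[leLHS]sqrtCK lerXn2r ?nnegrE ?sqrtC_ge0 ?(ltW k0)//.
  by rewrite lerDl.
by rewrite mulrC -ltr_pdivlMr// distrC.
Qed.

Let lactDl a b (x : X) : mw_lact (a + b) x = mw_lact a x + mw_lact b x.
Proof. by apply/contCP => p; exact: mulrDl. Qed.
Let lactZl (c : R[i]) a (x : X) : mw_lact (c *: a) x = c *: mw_lact a x.
Proof. by apply/contCP => p; rewrite contCZE /= /mw_lact_fun contCZE mulrA. Qed.
Let lactM a b (x : X) : mw_lact (amul a b) x = mw_lact a (mw_lact b x).
Proof. by apply/contCP => p; rewrite /= /mw_lact_fun mulrA. Qed.

Let lact_adjoint a (x y : X) :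
  mw_inner (mw_lact a x) y = mw_inner x (mw_lact (astar a) y).
Proof.
apply/contCP => p; apply: eq_bigr => e _.
have [[t [_ F]]|F] := untag_case e p; rewrite !F//=.
by rewrite /mw_lact_fun rmorphM mulrAC [LHS]mulrC.
Qed.

HB.instance Definition _ := GRing.Lmodule.on mw_corr.
HB.instance Definition _ := Lmodule_isCorrespondence.Build R A mw_corr
  ractDl ractDr ractZl ractZr ractA innerDr innerZr inner_ract inner_star
  inner_ge0 inner_eq0 inner_complete lactDl lactZl lactM lact_adjoint.

Record invariant_family (K : forall v, set (mw_space G v)) : Prop :=
  InvariantFamily {
    invariant_nonempty : forall v, K v !=set0;
    invariant_compact : forall v, compact (K v);
    invariantE : forall v, @to_total v @` K v =
      \bigcup_(e in [set e | mw_source G e = v]) (@to_total _ \o mw_map G e) @`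
        K (mw_range G e)
  }.

Definition invariant_set (K : forall v, set (mw_space G v)) : set total_space :=
  \bigcup_v @to_total v @` K v.

Definition vanishing_ideal (K : set total_space) : set A :=
  [set a | forall p, K p -> a p = 0].

End mauldin_williams.

(* Main.v *)
(* Let chi_e be the indicator function of the copy of T_(r e) in E x_G T. The
   left action of a in A is the sum over e of theta (a chi_e) chi_e, and
   a chi_e = chi_e b_e where b_e is a o phi_e on T_(r e) and 0 elsewhere.
   Covariance thus gives k_A a = sum_e k_X chi_e k_A b_e (k_X chi_e)^*, so that
   k_A a = 0 as soon as all the k_A b_e are 0. By induction on n, k_A kills the
   functions vanishing on F^n(T), where F(Q) is the union of the
   phi_e (Q meet T_(r e)). If a vanishes on K then |a| <= eps on F^n(T) for n
   large, since F^n(T) shrinks to K; a differs from a truncation of modulus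
   <= eps by a function vanishing on F^n(T), hence |k_A a| <= eps. *)
Require Import Defs.
From mathcomp Require Import all_boot all_order all_algebra.
From mathcomp Require Import all_classical all_reals all_analysis.
From mathcomp Require Import complex ring.

Set Implicit Arguments.
Unset Strict Implicit.
Unset Printing Implicit Defensive.

Import Order.TTheory GRing.Theory Num.Theory.
Import numFieldNormedType.Exports.

Local Open Scope classical_set_scope.
Local Open Scope complex_scope.
Local Open Scope ring_scope.

(** * Real and imaginary parts of continuous functions *)

Section real_functions.
Context {R : realType} {X : compactType}.

Lemma real_complex_continuous : continuous (real_complex R : R -> R[i]^o).
Proof.
move=> x; apply/(@cvgrPdist_lt _ R[i]^o) => e /gt0_realC[d d0 ->].
have /(@cvgrPdist_lt _ R)/(_ _ d0) := @cvg_id _ (nbhs x).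
by apply: filterS => y; rewrite -rmorphB norm_realC ltcR.
Qed.

Lemma contC_real_subproof (g : X -> R) :
  continuous g -> continuous ((fun x => (g x)%:C) : X -> R[i]^o).
Proof.
by move=> cg x; exact: (continuous_comp (cg x) (@real_complex_continuous _)).
Qed.

Definition contC_real (g : X -> R) (cg : continuous g) : contC R X :=
  ContC (contC_real_subproof cg).

(** This reduces the vanishing of [pi] to real-valued functions, which can be truncated by means of
    the order of [R]. *)
Lemma contC_ReIm (a : contC R X) :
  exists (g h : X -> R) (cg : continuous g) (ch : continuous h),
    [/\ a = contC_real cg + 'i *: contC_real ch,
        forall x, g x = complex.Re (a x) & forall x, h x = complex.Im (a x)].
Proof.
have cg : continuous (fun x => complex.Re (a x)).
  by move=> x; exact: (continuous_comp (contC_continuous a x) (@Re_continuous R _)).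
have ch : continuous (fun x => complex.Im (a x)).
  by move=> x; exact: (continuous_comp (contC_continuous a x) (@Im_continuous R _)).
exists _, _, cg, ch; split=> //.
by apply/contCP => x; rewrite contCDE contCZE /= -complexE.
Qed.

End real_functions.

(** * Norm bounds for *-homomorphisms on $C(X)$ *)

Section star_hom_norm.
Context {R : realType} {B : cstarAlgType R}.

Lemma amul0l (x : B) : amul 0 x = 0.
Proof. by rewrite -(scale0r (0 : B)) amulZl !scale0r. Qed.

Lemma amul0r (x : B) : amul x 0 = 0.
Proof. by rewrite -(scale0r (0 : B)) amulZr !scale0r. Qed.

Lemma sqr_le_norm_le1 (x : B) : `|x| ^+ 2 <= `|x| -> `|x| <= 1.
Proof.
have [->|x0] := eqVneq `|x| 0; first by rewrite ler01.
by rewrite expr2 ger_pMr// lt_def x0 normr_ge0.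
Qed.

Context {X : compactType} (pi : contC R X -> B) (pih : star_hom pi).

Lemma contC_one_subproof : continuous ((fun=> 1) : X -> R[i]^o).
Proof. by move=> x; exact: cvg_cst. Qed.

Definition contC_one : contC R X := ContC contC_one_subproof.

(** [B] may have no unit, but $1^*1 = 1$ in $C(X)$, so the $C^*$-identity makes the squared norm of
    the image of 1 equal to its norm. *)
Lemma star_hom_one_le1 : `|pi contC_one| <= 1.
Proof.
apply: sqr_le_norm_le1.
rewrite -cstar_identity -(star_homV pih) -(star_homM pih).
rewrite (_ : amul _ _ = contC_one)//; apply/contCP => x.
by rewrite contC_mulE contC_conjE /= mulr1 conjC1.
Qed.

(** By the $C^*$-identity, since $u^*u = 1$. *)
Lemma star_hom_unitary_le1 (u : contC R X) :
  (forall x, `|u x| = 1) -> `|pi u| <= 1.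
Proof.
move=> u1; rewrite -(@ler_pXn2r _ 2) ?nnegrE// expr1n.
rewrite -cstar_identity -(star_homV pih) -(star_homM pih).
rewrite (_ : amul _ _ = contC_one) ?star_hom_one_le1//; apply/contCP => x.
by rewrite contC_mulE contC_conjE /= mulrC -normCK u1 expr1n.
Qed.

(* A real function g with values in [-1, 1] is the mean of the two unitary
   functions g +- i sqrt(1 - g^2). *)
Lemma star_hom_real_le1 (g : X -> R) (cg : continuous g) :
  (forall x, `|g x| <= 1) -> `|pi (contC_real cg)| <= 1.
Proof.
move=> g1.
have cs : continuous (fun x => Num.sqrt (1 - g x ^+ 2)).
  move=> x.
  apply: (@continuous_comp _ R R (fun y => 1 - g y ^+ 2) (@Num.sqrt R));
    last exact: sqrt_continuous.
  apply: (@cvgB _ R^o); first exact: cvg_cst.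
  by under eq_fun do rewrite expr2; apply: (@cvgM R); exact: cg.
pose s := contC_real cs.
have s2 x : Num.sqrt (1 - g x ^+ 2) ^+ 2 = 1 - g x ^+ 2.
  by rewrite sqr_sqrtr// subr_ge0 -real_normK ?num_real// expr_le1.
have -> : contC_real cg =
    2^-1 *: ((contC_real cg + 'i *: s) + (contC_real cg - 'i *: s)).
  by apply/contCP => x; rewrite contCZE !contCDE contCNE contCZE; field.
rewrite (star_homZ pih) (star_homD pih) normrZ ger0_norm ?invr_ge0//.
rewrite ler_pdivrMl// mulr1 (le_trans (ler_normD _ _))//.
rewrite (_ : 2 = 1 + 1)// lerD//.
  apply: star_hom_unitary_le1 => x; rewrite contCDE contCZE /= normc_def /=.
  by rewrite !(mul0r, mul1r, mulr0, addr0, add0r, subr0, oppr0) s2 subrKC sqrtr1.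
apply: star_hom_unitary_le1 => x; rewrite contCDE contCNE contCZE /= normc_def /=.
by rewrite !(mul0r, mul1r, mulr0, addr0, add0r, subr0, oppr0) sqrrN s2 subrKC sqrtr1.
Qed.

Lemma star_hom_real_le (g : X -> R) (cg : continuous g) (e : R) :
  0 < e -> (forall x, `|g x| <= e) -> `|pi (contC_real cg)| <= e%:C.
Proof.
move=> e0 ge.
have ch : continuous (fun x => e^-1 * g x).
  by move=> x; apply: (@cvgM R); [exact: cvg_cst|exact: cg].
have -> : contC_real cg = e%:C *: contC_real ch.
  by apply/contCP => x; rewrite contCZE /= -rmorphM /= mulVKf// gt_eqF.
rewrite (star_homZ pih) normrZ norm_realC gtr0_norm// ger_pMr ?ltcR//.
apply: star_hom_real_le1 => x.
by rewrite normrM gtr0_norm ?invr_gt0// ler_pdivrMl// mulr1.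
Qed.

End star_hom_norm.

(** * Finite sums of rank-one operators under the induced homomorphism *)

Section induced_hom_theory.
Context {R : realType} {A : cstarAlgType R} {X : correspondenceType A}.
Context {B : cstarAlgType R} (psi : X -> B) (pi1 : (X -> X) -> B).
Hypothesis pi1P : induced_hom psi pi1.
Context (I : Type) (x y : I -> X).

Definition theta_sum (r : seq I) (z : X) : X := \sum_(i <- r) theta (x i) (y i) z.

Lemma innerDl (u v w : X) : inner (u + v) w = inner u w + inner v w.
Proof. by rewrite -inner_star innerDr astarD !inner_star. Qed.

Lemma inner0r (u : X) : inner u 0 = 0.
Proof. by rewrite -(scale0r 0) innerZr scale0r. Qed.

Lemma inner0l (u : X) : inner 0 u = 0.
Proof. by rewrite -inner_star inner0r -(scale0r (0 : A)) astarZ rmorph0 !scale0r. Qed.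

Lemma theta_adjoint (u v : X) : adjoint_pair (theta u v) (theta v u).
Proof.
move=> a b; rewrite /theta inner_ract -[LHS]inner_star inner_ract astarM.
by rewrite !inner_star.
Qed.

(** An adjoint is the sum of the operators [theta (y i) (x i)]. The sum is its own approximant in
    [theta_span], with error 0. *)
Lemma theta_sum_compact (r : seq I) : compact_op (theta_sum r).
Proof.
split.
  rewrite /theta_sum; elim: r => [|i r [S' IH]].
    by exists (fun=> 0) => a b; rewrite big_nil inner0l inner0r.
  exists (fun z => theta (y i) (x i) z + S' z) => a b.
  by rewrite big_cons innerDl innerDr theta_adjoint IH.
move=> e e0; exists (theta_sum r).
  exists (size r), (fun=> 1), (x \o tnth (in_tuple r)), (y \o tnth (in_tuple r)).
  apply/funext => z; rewrite /theta_sum big_tnth.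
  by apply: eq_bigr => i _; rewrite scale1r.
move=> z; rewrite subrr /hnorm inner0r normr0 sqrtC0.
by rewrite mulr_ge0 ?sqrtC_ge0// ltW.
Qed.

(** Induction on the list; additivity of [pi1] holds on compact operators, hence the compactness of
    every partial sum. *)
Lemma induced_hom_theta_sum (r : seq I) :
  pi1 (theta_sum r) = \sum_(i <- r) amul (psi (x i)) (astar (psi (y i))).
Proof.
have thK s : compact_op (theta_sum s) by exact: theta_sum_compact.
elim: r => [|i r IH].
  (* The empty sum is 0 times itself, so homogeneity gives the value 0. *)
  rewrite big_nil -(scale0r (pi1 (theta_sum [::]))).
  rewrite -(induced_homZ pi1P) //; congr pi1.
  by apply/funext => z; rewrite scale0r /theta_sum big_nil.
rewrite big_cons -IH -(induced_hom_theta pi1P).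
have -> : theta (x i) (y i) = theta_sum [:: i].
  by apply/funext => z; rewrite /theta_sum big_seq1.
rewrite -(induced_homD pi1P) //; congr pi1.
by apply/funext => z; rewrite /theta_sum big_cons big_seq1.
Qed.

Lemma covariant_theta_sum (pi : A -> B) (r : seq I) (a : A) :
  (forall b, covariance_ideal X b -> pi1 (lact b) = pi b) ->
  lact a = theta_sum r ->
  pi a = \sum_(i <- r) amul (psi (x i)) (astar (psi (y i))).
Proof.
move=> cov ar; rewrite -induced_hom_theta_sum -ar cov//.
by rewrite /covariance_ideal /= ar; exact: theta_sum_compact.
Qed.

End induced_hom_theory.

(** * The left action as a finite sum over edges *)

Section pullback.
Context {R : realType} (G : mauldin_williams R).
Local Notation A := (contC R (total_space G)).

Lemma edge_indic_subproof (e : mw_edge G) :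
  continuous ((fun p : edge_space G => (tag p == e)%:R) : _ -> R[i]^o).
Proof. by apply: edge_space_continuous => f x; exact: cvg_cst. Qed.

Definition edge_indic (e : mw_edge G) : mw_corr G :=
  ContC (@edge_indic_subproof e).

Lemma pullback_subproof (a : A) (e : mw_edge G) :
  continuous ((fun p => untag 0 (fun x : mw_space G (mw_range G e) =>
    a (to_total (mw_map G e x))) p) : total_space G -> R[i]^o).
Proof.
apply: untag_continuous => x; exact: (continuous_comp (continuous_comp
  (@mw_map_continuous _ _ e x) (@to_total_continuous _ _ _ _))
  (contC_continuous a _)).
Qed.

Definition pullback (a : A) (e : mw_edge G) : A := ContC (@pullback_subproof a e).

Lemma lact_edge_indic (a : A) (e : mw_edge G) :
  lact a (edge_indic e) = ract (edge_indic e) (pullback a e).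
Proof.
apply/contCP => -[f x]; rewrite /= /mw_lact_fun /mw_ract_fun /=.
have [fe|_] := eqVneq f e; last by rewrite mulr0 mul0r.
by subst f; rewrite untag_to_total mulr1 mul1r.
Qed.

(** The indicators have disjoint supports: at a point of the copy of edge [f], only the index [f]
    survives, both in the sum of operators and in the inner product. *)
Lemma lact_theta_sum (a : A) : lact a =
  theta_sum (fun e => lact a (edge_indic e)) edge_indic (index_enum (mw_edge G)).
Proof.
apply/funext => z; apply/contCP => -[f x]; rewrite /theta_sum.
have sumE (r : seq (mw_edge G)) (F : mw_edge G -> mw_corr G) p :
    (\sum_(e <- r) F e) p = \sum_(e <- r) F e p.
  by elim: r => [|e r IH]; rewrite ?big_nil// !big_cons contCDE IH.
rewrite sumE (bigD1 f)//= big1 ?addr0.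
  rewrite /mw_ract_fun /= /mw_inner_fun (bigD1 f)//= big1 ?addr0.
    rewrite untag_to_total /mw_lact_fun /= eqxx mulr1 rmorph1 mul1r.
    by rewrite /mw_lact_fun.
  move=> e ef; have [[y [_ ->]]|-> //] := untag_case e (to_total x).
  by rewrite /= (negbTE ef) rmorph0 mul0r.
(* Remaining terms of the outer sum: the indicator of [e] is 0 on the copy of [f]. *)
move=> e ef; rewrite /= /mw_ract_fun /= /mw_lact_fun /= eq_sym (negbTE ef).
by rewrite mulr0 mul0r.
Qed.

Section vanishing.
Context (B : cstarAlgType R) (psi : mw_corr G -> B) (pi : A -> B).
Hypothesis cov : covariant_toeplitz psi pi.

Lemma covariant_pullback_eq0 (a : A) :
  (forall e, pi (pullback a e) = 0) -> pi a = 0.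
Proof.
case: cov => tp [pi1 pi1P pi1E] ae0.
rewrite (covariant_theta_sum pi1P pi1E (lact_theta_sum a)) big1// => e _.
by rewrite lact_edge_indic (toeplitz_ract tp) ae0 amul0r amul0l.
Qed.

(** The Hutchinson operator of the system on the disjoint union, written [F] in the outline
    above. *)
Definition mw_image (Q : set (total_space G)) : set (total_space G) :=
  [set p | exists e (x : mw_space G (mw_range G e)),
    Q (to_total x) /\ p = to_total (mw_map G e x)].

(** The induction is over all [a] at once, since its step passes from [a] to its pullbacks: if [a]
    vanishes on $F^{n+1}(T)$, they vanish on $F^n(T)$. *)
Lemma covariant_vanishing_iter (n : nat) (a : A) :
  (forall p, iter n mw_image setT p -> a p = 0) -> pi a = 0.
Proof.
elim: n a => [|n IH] a a0.
  have -> : a = 0 by apply/contCP => p; exact: a0.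
  have sh := toeplitz_star_hom cov.1.
  by rewrite -(scale0r (0 : A)) (star_homZ sh) scale0r.
apply: covariant_pullback_eq0 => e; apply: IH => p pn /=.
have [[x [px ->]]|-> //] := untag_case e p.
by apply: a0; exists e, x; rewrite -px.
Qed.

End vanishing.

(** * Shrinking of the iterated images to the invariant set *)

Section attractor.
Context (K : forall v : mw_vertex G, set (mw_space G v)).
Hypothesis K_inv : invariant_family K.

(** Compactness in filter form: a bound valid locally and eventually is eventually valid everywhere.
    It yields both boundedness and uniform continuity below. *)
Lemma near_covering_space (I : Type) (F : set_system I) v
    (P : I -> mw_space G v -> Prop) : Filter F ->
  (forall x : mw_space G v, \forall y \near x & i \near F, P i y) ->
  \forall i \near F, forall x, P i x.
Proof.
move=> FF Px.
have := (compact_near_coveringP _).1 (@compact_setT (mw_space G v)) I F P FF.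
move=> /(_ (fun x _ => Px x)); apply: filterS => i Pi x; exact: Pi.
Qed.

(** Distances to a base point are locally bounded, hence bounded on each compact piece; a common
    bound exists as there are finitely many vertices. *)
Lemma mw_space_bounded : exists D : R,
  forall v (x y : mw_space G v), mdist x y <= D.
Proof.
have bnd : \forall D \near +oo, forall v (x : mw_space G v),
    mdist (projT1 (cid (mw_space_nonempty v))) x <= D.
  apply: filter_forall => v; set x0 := projT1 _.
  apply: near_covering_space => x; near=> y D => /=.
  apply: le_trans (_ : mdist x0 x + 1 <= D).
    apply: (le_trans (metric_triangle _ x _)); rewrite lerD2l ltW//.
    have : ball x 1 y by near: y; exact: nbhsx_ballx.
    by rewrite ballEmdist.
  near: D; apply: nbhs_pinfty_ge; exact: num_real.
have [D DP] : exists D : R, forall v (x : mw_space G v),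
    mdist (projT1 (cid (mw_space_nonempty v))) x <= D.
  by near (+oo : set_system R) => D; exists D; near: D.
exists (D + D) => v x y; set x0 := projT1 (cid (mw_space_nonempty v)).
by rewrite (le_trans (metric_triangle x x0 y))// lerD// metric_sym.
Unshelve. all: by end_near. Qed.

Lemma mw_unif_continuous (g : total_space G -> R) (e : R) :
  continuous g -> 0 < e -> exists2 d : R, 0 < d &
  forall v (x y : mw_space G v), mdist x y < d ->
    `|g (to_total x) - g (to_total y)| < e.
Proof.
move=> cg e0; have e20 : 0 < e / 2 by rewrite divr_gt0.
have unif : \forall d \near 0^'+, forall v (x y : mw_space G v),
    mdist x y < d -> `|g (to_total x) - g (to_total y)| < e.
  apply: filter_forall => v; apply: near_covering_space => x.
  have : \forall y \near x, `|g (to_total x) - g (to_total y)| < e / 2.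
    have := continuous_comp (@to_total_continuous _ _ v x) (cg _).
    by move=> /(@cvgrPdist_lt _ R)/(_ _ e20).
  move=> /nbhs_ballP[r /= r0 rP].
  have r20 : 0 < r / 2 by rewrite divr_gt0.
  (* With [y] within [r / 2] of [x] and [d <= r / 2], both [y] and [z] lie in the ball of radius [r]
     about [x]. *)
  near=> y d => z /= yz.
  have xy : ball x (r / 2) y by near: y; exact: nbhsx_ballx.
  have xz : ball x r z.
    rewrite (splitr r); apply: (ball_triangle xy); rewrite ballEmdist /=.
    by rewrite (lt_le_trans yz)//; near: d; exact: nbhs_right_le.
  have xry : ball x r y.
    by apply: le_ball xy; rewrite ler_pdivrMr// ler_peMr ?ltW// ltr1n.
  rewrite -(subrKA (g (to_total x))) (splitr e).
  rewrite (le_lt_trans (ler_normD _ _))// ltrD//; last exact: rP.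
  by rewrite distrC; exact: rP.
near (0 : R)^'+ => d; exists d; last by near: d.
by near: d; exact: nbhs_right_gt.
Unshelve. all: by end_near. Qed.

Lemma invariant_set_map e (x : mw_space G (mw_range G e)) :
  invariant_set K (to_total x) -> invariant_set K (to_total (mw_map G e x)).
Proof.
move=> [v _ [y Ky yx]]; exists (mw_source G e) => //.
have ev := existT_inj1 yx; subst v; have xy := existT_inj2 yx; subst y.
by rewrite (invariantE K_inv); exists e => //; exists x.
Qed.

(** Start from any point of the nonempty [K v], at distance at most [D]. Applying the same edge map
    to both points keeps the second in the invariant set and gains a factor [c]. *)
Lemma iter_mw_image_dist (D c : R) : 0 <= c ->
  (forall v (x y : mw_space G v), mdist x y <= D) ->
  (forall e (x y : mw_space G (mw_range G e)),
    mdist (mw_map G e x) (mw_map G e y) <= c * mdist x y) ->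
  forall n p, iter n mw_image setT p -> exists v (x y : mw_space G v),
    [/\ p = to_total x, invariant_set K (to_total y) & mdist x y <= D * c ^+ n].
Proof.
move=> c0 DP cP; elim=> [|n IH] p /=.
  move=> _; case: p => v x; have [y Ky] := invariant_nonempty K_inv v.
  exists v, x, y; split=> //; first by exists v => //; exists y.
  by rewrite expr0 mulr1.
move=> [e [x [/IH[v [x' [y [xx' Ky xy]]]] ->]]].
have ev := existT_inj1 xx'; subst v; have xE := existT_inj2 xx'; subst x'.
exists (mw_source G e), (mw_map G e x), (mw_map G e y); split=> //.
  exact: invariant_set_map.
by rewrite (le_trans (cP _ _ _))// exprS mulrCA ler_wpM2l.
Qed.

(** Choose [n] with [D * c ^+ n] below the modulus of uniform continuity of [g] for [e], and compare
    with a nearby point of the invariant set, where [g] is 0. *)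
Lemma vanishing_small_iter (g : total_space G -> R) (e : R) :
  continuous g -> (forall p, invariant_set K p -> g p = 0) -> 0 < e ->
  exists n, forall p, iter n mw_image setT p -> `|g p| <= e.
Proof.
move=> cg gK e0; have [c /andP[c0 c1] cP] := mw_map_contraction G.
have [D DP] := mw_space_bounded.
have [d d0 dP] := mw_unif_continuous cg e0.
have c1' : `|c| < 1 by rewrite gtr0_norm.
have /(@cvgrPdist_lt _ R)/(_ _ d0)[n _ nd] := cvg_geometric D c1'.
exists n => p /(iter_mw_image_dist (ltW c0) DP cP)[v [x [y [-> Ky xy]]]].
have := nd n (leqnn _); rewrite /= sub0r normrN => nd'.
have /dP : mdist x y < d.
  by rewrite (le_lt_trans xy)// (le_lt_trans _ nd')// ler_norm.
by rewrite (gK _ Ky) subr0 => /ltW.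
Qed.

Context (B : cstarAlgType R) (psi : mw_corr G -> B) (pi : A -> B).
Hypothesis cov : covariant_toeplitz psi pi.

Lemma covariant_vanishing_real (g : total_space G -> R) (cg : continuous g) :
  (forall p, invariant_set K p -> g p = 0) -> pi (contC_real cg) = 0.
Proof.
move=> gK; have sh := toeplitz_star_hom cov.1.
apply/eqP; rewrite -normr_le0; apply/ler_addgt0Pl => _ /gt0_realC[e e0 ->].
rewrite addr0; have [n ne] := vanishing_small_iter cg gK e0.
(* Clamp [g] to $[-e, e]$: [t] agrees with [g] wherever [|g| <= e], so the difference is killed by
   [pi] and only the image of [t] counts. *)
pose t p := Num.max (- e) (Num.min e (g p)).
have ct : continuous t.
  move=> p; apply: (@continuous_max _ _ (fun=> - e) (fun p => Num.min e (g p))).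
    exact: cst_continuous.
  by apply: (@continuous_min _ _ (fun=> e) g); [exact: cst_continuous|exact: cg].
have te p : `|t p| <= e.
  by rewrite ler_norml /t le_max lexx /= ge_max ge_min lexx /= ge0_cp// ltW.
have -> : contC_real cg = (contC_real cg - contC_real ct) + contC_real ct.
  by rewrite subrK.
rewrite (star_homD sh) (@covariant_vanishing_iter _ psi _ cov n) ?add0r.
  exact: star_hom_real_le.
move=> p /ne; rewrite ler_norml => /andP[ge1 ge2].
by rewrite contCBE /= /t min_r// max_r// subrr.
Qed.

Lemma covariant_vanishing (a : A) :
  vanishing_ideal (invariant_set K) a -> pi a = 0.
Proof.
move=> aK; have [g [h [cg [ch [aE gE hE]]]]] := contC_ReIm a.
have sh := toeplitz_star_hom cov.1.
rewrite aE (star_homD sh) (star_homZ sh) !covariant_vanishing_real ?scaler0 ?addr0//.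
  by move=> p /aK; rewrite hE => ->.
by move=> p /aK; rewrite gE => ->.
Qed.

End attractor.

End pullback.

Theorem proposition2p5 (R : realType) (G : mauldin_williams R)
  (G_no_sinks : no_sinks G) (G_no_sources : no_sources G)
  (K : forall v : mw_vertex G, set (mw_space G v)) (K_invariant : invariant_family K)
  (K_proper : invariant_set K `<` [set: total_space G])
  (O : cstarAlgType R) (kX : mw_corr G -> O) (kA : contC R (total_space G) -> O)
  (O_cuntz_pimsner : cuntz_pimsner kX kA) :
  ideal_generated (kA @` vanishing_ideal (invariant_set K)) = [set 0].
Proof.
have cov := cuntz_pimsner_covariant O_cuntz_pimsner.
apply/seteqP; split; last by move=> _ -> I [I_ideal _]; exact: closed_ideal0.
(* It suffices that [[set 0]] is itself one of the intersected ideals: it contains the generators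
   because [kA] kills them all. *)
apply: bigcap_inf; split=> /=; last first.
  by move=> _ [a /(covariant_vanishing K_invariant cov) ? <-].
split=> //=.
- by apply: accessible_closed_set1; exact: hausdorff_accessible (@norm_hausdorff _ _).
- by move=> _ _ -> ->; rewrite addr0.
- by move=> c _ ->; rewrite scaler0.
- by move=> x _ ->; exact: amul0r.
- by move=> _ y ->; exact: amul0l.
Qed.
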